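(* Let $q$ be a power of an odd prime, let $n$ be an odd positive integer coprime to $q$, let $\gamma$ be an integer, and let $c_{n/q}(\gamma)$ be the $q$-cyclotomic coset modulo $n$ containing $\gamma$, with $|c_{n/q}(\gamma)|=\tau$. Assume that $q^{\tau}\equiv1\pmod4$. Then: (1) The generator $\varphi_n(\gamma)$ at infinity gives rise to an element $$c_\infty=(c_{2^in/q}(\gamma+n\cdot\varphi_n(\gamma)_{\le i-1}))_{i\in\mathbb{N}}\in\mathcal{PC}_{n/q}(\gamma),$$ where $\varphi_n(\gamma)_{\le-1}$ is set to be $0$. It is the unique splitting element of $\mathcal{PC}_{n/q}(\gamma)$. (2) For each $d\in\mathbb{N}$, the $d$-th generator $U_d(\gamma)$ gives rise to $2^{v^+-1}$ elements $$c_{d,t}=(c_{2^in/q}(\gamma+n\cdot\widehat{U}_{d,t}(\gamma)_{\le i-1}))_{i\in\mathbb{N}}\in\mathcal{PC}_{n/q}(\gamma),$$ where $v^+=v_2(q^{\tau}-1)$, $t=(t_1,\dots,t_{v^+-1})\in\{0,1\}^{v^+-1}$, and $\widehat{U}_{d,t}(\gamma)=U_d(\gamma)+\sum_{j=1}^{v^+-1}t_j\cdot2^{d+j}$; here $\widehat{U}_{d,t}(\gamma)_{\le-1}$ is set to be $0$. Furthermore, the element $c_\infty$ and the elements $c_{d,t}$, for all $d\in\mathbb{N}$ and all $t\in\{0,1\}^{v^+-1}$, are pairwise distinct and exhaust $\mathcal{PC}_{n/q}(\gamma)$.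
   Context: $\mathbb{N}=\{0,1,2,\dots\}$. For $N\ge 1$ coprime to $q$, $c_{N/q}(\gamma)=\{\gamma q^j\bmod N:j\ge0\}\subseteq\mathbb{Z}/N\mathbb{Z}$ is the $q$-cyclotomic coset modulo $N$ containing $\gamma$, and $\mathcal{C}_{N/q}$ is the set of all such cosets. For $a\mid b$ coprime to $q$, $\pi_{b/a}:\mathbb{Z}/b\mathbb{Z}\to\mathbb{Z}/a\mathbb{Z}$ is the projection and $\widehat{\pi}_{b/a}:\mathcal{C}_{b/q}\to\mathcal{C}_{a/q}$ the induced map $c_{b/q}(\gamma)\mapsto c_{a/q}(\gamma)$. The $2$-adic $q$-cyclotomic system over $c_{n/q}(\gamma)$ is $\mathcal{PC}_{n/q}(\gamma)=\varprojlim_{i\in\mathbb{N}}\widehat{\pi}_{2^in/n}^{-1}(c_{n/q}(\gamma))$, i.e. the set of sequences $(c_{2^in/q}(\gamma_i))_{i\in\mathbb{N}}$ of cosets, with $0$-th component $c_{n/q}(\gamma)$, compatible under the maps $\widehat{\pi}$. A coset $c_{m/q}(\gamma)$ is splitting with respect to $\mathbb{Z}/2m\mathbb{Z}:\mathbb{Z}/m\mathbb{Z}$ if $\pi_{2m/m}^{-1}(c_{m/q}(\gamma))=c_{2m/q}(\gamma)\sqcup c_{2m/q}(m+\gamma)$ (disjoint cosets); otherwise the preimage is the single coset $c_{2m/q}(\gamma)=c_{2m/q}(m+\gamma)$. A sequence $(c_{2^in/q}(\gamma_i))_i\in\mathcal{PC}_{n/q}(\gamma)$ splits at degree $i_0$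 if $c_{2^{i_0}n/q}(\gamma_{i_0})$ is splitting with respect to $\mathbb{Z}/2^{i_0+1}n\mathbb{Z}:\mathbb{Z}/2^{i_0}n\mathbb{Z}$; it is splitting if it splits at every degree. For an integer $\gamma$, the cyclotomic $2$-adic integer $\varphi_n(\gamma)=\sum_{k\ge0}\phi_{n,k}(\gamma)2^k$, $\phi_{n,k}(\gamma)\in\{0,1\}$, is the unique such formal $2$-adic power series with $2^{i+1}\mid\gamma+n\cdot\varphi_n(\gamma)_{\le i}$ for all $i\in\mathbb{N}$. It is called the generator at infinity of $\mathcal{PC}_{n/q}(\gamma)$. For a series $Y=\sum_k y_k2^k$ with $y_k\in\{0,1\}$, $Y_{\le i}=\sum_{k=0}^iy_k2^k$. For $d\in\mathbb{N}$, the $d$-th generator is $U_d(\gamma)=\sum_{k=0}^{d-1}\phi_{n,k}(\gamma)2^k+(1-\phi_{n,d}(\gamma))2^d$. *)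

(* Defs.v *)
From mathcomp Require Import all_boot all_order all_algebra.
From mathcomp Require Import zify.
From mathcomp Require Import boolp classical_sets.

Set Implicit Arguments.
Unset Strict Implicit.
Unset Printing Implicit Defensive.
Import Order.TTheory GRing.Theory Num.Theory.
Local Open Scope ring_scope.

(* Z/NZ for N >= 1. The type 'Z_N is unsuitable, as 'Z_1 has two elements and
   N = 1 is allowed here. *)
Definition Zmod (N : nat) : finType := 'I_N.-1.+1.

Definition zres (N : nat) (g : int) : Zmod N := inord (absz (g %% N%:Z)%Z).

Definition proj (b a : nat) (x : Zmod b) : Zmod a := zres a (val x)%:Z.
Arguments proj : clear implicits.

Definition cyc (q N : nat) (g : int) : {set Zmod N} :=
  finset (fun x : Zmod N =>
    `[< exists j : nat, x = zres N (g * (q ^ j)%N%:Z) >]).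

Definition cosets (q N : nat) : set {set Zmod N} := range (cyc q N).
Arguments cosets : clear implicits.

(* The map induced on cosets by [proj]; see [hatproj_cyc]. *)
Definition hatproj (b a : nat) (C : {set Zmod b}) : {set Zmod a} :=
  [set proj b a x | x in C]%SET.

Definition coset_seq (n : nat) := forall i : nat, {set Zmod (2 ^ i * n)%N}.

(* The inverse limit of the fibres of [hatproj] over the coset of [g] mod n;
   the fibre condition at i = 0 says that the 0-th component is that coset. *)
Definition PC (q n : nat) (g : int) : set (coset_seq n) :=
  fun c =>
    (forall i, cosets q (2 ^ i * n)%N (c i) /\ hatproj n (c i) = cyc q n g) /\
    (forall i j, (i <= j)%N -> hatproj (2 ^ i * n)%N (c j) = c i).
Arguments PC : clear implicits.

Definition splitting (q m : nat) (g : int) : Prop :=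
  (proj (2 * m)%N m @^-1: cyc q m g)%SET
    = (cyc q (2 * m)%N g :|: cyc q (2 * m)%N (m%:Z + g))%SET /\
  [disjoint cyc q (2 * m)%N g & cyc q (2 * m)%N (m%:Z + g)].

Definition splits_at (q n : nat) (c : coset_seq n) (i : nat) : Prop :=
  exists g : int, c i = cyc q (2 ^ i * n)%N g /\ splitting q (2 ^ i * n)%N g.

Definition splitting_seq (q n : nat) (c : coset_seq n) : Prop :=
  forall i, splits_at q c i.

(* A series sum_k y_k 2^k with y_k in {0,1} is given by its digits. *)
Definition series2 := nat -> bool.

(* The sum of the terms of degree < i, i.e. Y_{<= i-1}, with Y_{<= -1} = 0. *)
Definition trunc (Y : series2) (i : nat) : nat :=
  (\sum_(k < i) Y k * 2 ^ k)%N.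

Definition is_phi (n : nat) (g : int) (Y : series2) : Prop :=
  forall i : nat, ((2 ^ i.+1)%N%:Z %| g + n%:Z * (trunc Y i.+1)%:Z)%Z.

(* The series singled out by [is_phi]; see [is_phi_exists_unique]. *)
Definition phi (n : nat) (g : int) : series2 :=
  xget (fun=> false) (is_phi n g).

Definition U (n : nat) (g : int) (d : nat) : series2 :=
  fun k => if (k < d)%N then phi n g k
           else if k == d then ~~ phi n g d else false.

(* U_d + sum_(1 <= j <= r) t_j 2^(d+j), digit by digit: no carry occurs. The
   tuple is numbered from 0, so t_j is [nth false t j.-1]; see [trunc_Uhat]. *)
Definition Uhat (n : nat) (g : int) (d r : nat) (t : r.-tuple bool) : series2 :=
  fun k => if (k <= d)%N then U n g d k else nth false t (k - d).-1.

Definition gen (q n : nat) (g : int) (Y : series2) : coset_seq n :=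
  fun i => cyc q (2 ^ i * n)%N (g + n%:Z * (trunc Y i)%:Z).

Lemma val_zres N g : (0 < N)%N -> (val (zres N g))%:Z = (g %% N%:Z)%Z.
Proof.
move=> N0; have h0 : (0 <= g %% N%:Z)%Z by apply: modz_ge0; lia.
have h1 : (g %% N%:Z < N%:Z)%Z by apply: ltz_pmod.
by rewrite /zres /= inordK; lia.
Qed.

Lemma hatproj_cyc q b a g : (0 < b)%N -> (a %| b)%N ->
  hatproj a (cyc q b g) = cyc q a g.
Proof.
move=> b0 ab.
have P h : proj b a (zres b h) = zres a h.
  rewrite /proj val_zres // /zres; congr (inord (absz _)).
  case/dvdnP: ab => k ->; rewrite [in RHS](divz_eq h (k * a)%N%:Z).
  by set z := (h %/ _)%Z; rewrite {2}PoszM mulrA modzMDl.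
apply/setP => x; rewrite inE; apply/imsetP/asboolP.
  by case=> y; rewrite inE => /asboolP[j ->] ->; exists j; rewrite P.
case=> j ->; exists (zres b (g * (q ^ j)%N%:Z)); last by rewrite P.
by rewrite inE; apply/asboolP; exists j.
Qed.

Lemma truncS Y i : trunc Y i.+1 = (trunc Y i + Y i * 2 ^ i)%N.
Proof. by rewrite /trunc big_ord_recr. Qed.

Lemma is_phi_exists_unique n g : odd n -> exists! Y, is_phi n g Y.
Proof.
move=> n_odd.
pose bit j m := ~~ ((2 ^ j.+1)%N%:Z %| g + n%:Z * m%:Z)%Z.
pose s := fix s i := if i is j.+1 then (s j + bit j (s j) * 2 ^ j)%N else 0%N.
pose Y : series2 := fun j => bit j (s j).
have sE i : trunc Y i = s i.
  by elim: i => [|i IH]; [rewrite /trunc big_ord0|rewrite truncS IH].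
have step (x : int) i : ((2 ^ i)%N%:Z %| x)%Z ->
    ((2 ^ i.+1)%N%:Z %| x + n%:Z * (2 ^ i)%N%:Z)%Z = ~~ ((2 ^ i.+1)%N%:Z %| x)%Z.
  move=> /dvdzP[y ->]; rewrite expnS PoszM -mulrDl.
  have p0 : (2 ^ i)%N%:Z != 0 by have := expn_gt0 2 i; lia.
  by rewrite !dvdz_mul2r //; move: n_odd; lia.
have YP i : ((2 ^ i)%N%:Z %| g + n%:Z * (trunc Y i)%:Z)%Z.
  elim: i => [|i IH]; first by rewrite expn0 dvd1z.
  have := step _ _ IH; rewrite truncS.
  have -> : Y i = bit i (trunc Y i) by rewrite sE.
  rewrite /bit; case: (boolP (_ %| _)%Z) => /= h e; first by rewrite mul0n addn0.
  by rewrite mul1n PoszD mulrDr addrA e.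
exists Y; split=> [i|Z ZP]; first exact: YP.
apply/funext; elim/ltn_ind => k IH.
have tE : trunc Z k = trunc Y k by apply: eq_bigr => j _; rewrite IH.
have := YP k.+1; have := ZP k; have := step _ _ (YP k); rewrite !truncS tE.
case: (Y k) (Z k) => [] [] //=; rewrite ?mul0n ?mul1n ?addn0 PoszD mulrDr addrA.
  by move=> -> ->.
by move=> -> /negbTE ->.
Qed.

Lemma trunc_Uhat n g d r (t : r.-tuple bool) i : (d + r < i)%N ->
  trunc (Uhat n g d t) i =
  (\sum_(k < d) phi n g k * 2 ^ k + (1 - phi n g d) * 2 ^ d
   + \sum_(j < r) tnth t j * 2 ^ (d + j.+1))%N.
Proof.
move=> dri; rewrite /trunc.
have -> : i = (d.+1 + (r + (i - (d + r).+1)))%N by lia.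
rewrite big_split_ord /= big_split_ord /= big_ord_recr /=.
congr (_ + _)%N; first congr (_ + _)%N.
- by apply: eq_bigr => k _; rewrite /Uhat /U ltn_ord ltnW.
- by rewrite /Uhat /U leqnn ltnn eqxx; case: (phi n g d).
rewrite [X in (_ + X)%N]big1 ?addn0 => [|j _].
  apply: eq_bigr => j _; rewrite /Uhat (tnth_nth false) /= addSnnS.
  have -> : (d + j.+1 <= d)%N = false by lia.
  by rewrite addKn.
have -> : Uhat n g d t (d.+1 + (r + j))%N = false; last by rewrite mul0n.
rewrite /Uhat; have -> : (d.+1 + (r + j) <= d)%N = false by lia.
by rewrite nth_default // size_tuple; lia.
Qed.

Lemma phiP n g : odd n -> is_phi n g (phi n g).
Proof.
by case/(is_phi_exists_unique g) => Y [YP _]; apply: xgetPex; exists Y.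
Qed.

(* Main.v *)
(* Write Q = q^tau, so that v = v_2(Q - 1) >= 2. Two integers congruent to gamma
   mod n lie in the same coset mod 2^i n iff they differ mod 2^i by a power of Q,
   since q^j fixes gamma mod n only if tau divides j. The powers of Q are dense in
   1 + 2^v Z_2, so the orbit of x under Q in Z_2 is x + 2^(d+v) Z_2 when x has
   valuation d, and {0} when x = 0. The point 0 is the expansion phi; the ball of
   valuation d splits into 2^(v-1) orbits, told apart by the v - 1 digits
   following the d-th one. A coset mod 2^i n splits exactly when the orbit
   of its representative mod 2^(i+1) is a single point; this holds for every i
   only at the point 0. *)
Require Import Defs.
From mathcomp Require Import all_boot all_order all_algebra.
From mathcomp Require Import zify ring boolp cyclic.
Import Order.TTheory GRing.Theory Num.Theory.

Local Open Scope ring_scope.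

(** * Divisibility of integers *)

Lemma PoszX (a k : nat) : (a ^ k)%N%:Z = a%:Z ^+ k.
Proof. by elim: k => [|k IH] //; rewrite expnS exprS PoszM IH. Qed.

Lemma dvdz_sub_sym (N a b : int) : (N %| a - b)%Z = (N %| b - a)%Z.
Proof. by rewrite -opprB rpredN. Qed.

Lemma dvdz_sub_trans (b N a c : int) :
  (N %| a - b)%Z -> (N %| b - c)%Z -> (N %| a - c)%Z.
Proof. by move=> ab bc; rewrite -(subrK b a) -addrA rpredD. Qed.

Lemma dvdz_sub_iff (N a b : int) : (N %| a - b)%Z -> (N %| a)%Z = (N %| b)%Z.
Proof.
move=> ab; apply/idP/idP => [aN|bN]; last by rewrite -(subrK b a) rpredD.
by rewrite -(subKr a b) rpredB.
Qed.

Lemma dvdz_mul_expr (N x Q : int) k :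
  (N %| x * (Q - 1))%Z -> (N %| x * Q ^+ k - x)%Z.
Proof.
move=> xQ; elim: k => [|k IH]; first by rewrite mulr1 subrr dvdz0.
have -> : x * Q ^+ k.+1 - x = (x * Q ^+ k - x) * Q + x * (Q - 1).
  by rewrite exprS; ring.
by rewrite rpredD // dvdz_mulr.
Qed.

(** * Cosets as orbits of multiplication by [q] *)

Lemma zres_eqP {N a b} : (0 < N)%N ->
  zres N a = zres N b <-> (N%:Z %| a - b)%Z.
Proof.
move=> N0; rewrite -eqz_mod_dvd; split=> [E|/eqP E]; last by rewrite /zres E.
by rewrite -(val_zres a N0) E val_zres.
Qed.

Lemma exists_expr1 {N q} : (0 < N)%N -> coprime N q ->
  exists2 M, (0 < M)%N & (N%:Z %| q%:Z ^+ M - 1)%Z.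
Proof.
move=> N0; rewrite coprime_sym => /Euler_exp_totient E.
exists (totient N); first by rewrite totient_gt0.
by rewrite -PoszX -eqz_mod_dvd -[1]/(Posz 1) !modz_nat E.
Qed.

Lemma mem_cycP {q N g h} : (0 < N)%N ->
  zres N h \in cyc q N g <-> exists j, (N%:Z %| h - g * q%:Z ^+ j)%Z.
Proof.
move=> N0; rewrite inE; split=> [/asboolP|] [j].
  by rewrite zres_eqP // PoszX; exists j.
by rewrite -PoszX -zres_eqP // => E; apply/asboolP; exists j.
Qed.

Lemma cyc_zres {q N g x} : x \in cyc q N g -> exists h, x = zres N h.
Proof. by rewrite inE => /asboolP[j ->]; eexists. Qed.

Lemma eq_cycP {q N g h} : (0 < N)%N -> coprime N q ->
  cyc q N h = cyc q N g <-> exists j, (N%:Z %| h - g * q%:Z ^+ j)%Z.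
Proof.
move=> N0 Nq; split=> [E|].
  by apply/mem_cycP => //; rewrite -E; apply/mem_cycP => //; exists 0%N; rewrite mulr1 subrr.
have sub a b j : (N%:Z %| a - b * q%:Z ^+ j)%Z -> cyc q N a \subset cyc q N b.
  move=> ab; apply/fintype.subsetP => x xa; have [y xE] := cyc_zres xa; move: xa.
  rewrite xE => /(mem_cycP N0)[k ya]; apply/(mem_cycP N0); exists (j + k)%N.
  apply: dvdz_sub_trans ya _.
  by rewrite exprD mulrA -mulrBl dvdz_mulr.
case=> j hg; apply/eqP; rewrite eqEsubset (sub _ _ j hg) /=.
have [M M0 qM] := exists_expr1 N0 Nq.
(* As [q ^ M] is 1 mod [N], the power [q ^ (j * M.-1)] inverts [q ^ j] and leads from [h] back to
   [g]. *)
apply: (sub _ _ (j * M.-1)%N).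
have /(dvdz_mul_expr _ _ _ j) : (N%:Z %| g * (q%:Z ^+ M - 1))%Z by rewrite dvdz_mull.
rewrite -exprM dvdz_sub_sym => gM; apply: dvdz_sub_trans gM _.
have -> : (M * j = j + j * M.-1)%N by nia.
by rewrite exprD mulrA -mulrBl dvdz_mulr // dvdz_sub_sym.
Qed.

Lemma congr_cyc {q N} {g h : int} : (0 < N)%N -> coprime N q ->
  (N%:Z %| h - g)%Z -> cyc q N h = cyc q N g.
Proof. by move=> N0 Nq hg; apply/eq_cycP => //; exists 0%N; rewrite mulr1. Qed.

(** The size of the orbit is the least positive period [t] of [g]: the residues of [g * q ^ k] for
    [k < t] are distinct and exhaust it, and the exponents fixing [g] are the multiples of [t]. *)
Lemma card_cyc {q n g j} : (0 < n)%N -> coprime n q ->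
  (n%:Z %| g * q%:Z ^+ j - g)%Z = (#|cyc q n g| %| j)%N.
Proof.
move=> n0 nq.
pose P k := (0 < k)%N && (n%:Z %| g * q%:Z ^+ k - g)%Z.
have exP : exists k, P k.
  have [M M0 qM] := exists_expr1 n0 nq; exists M.
  rewrite /P M0 /=; have -> : g * q%:Z ^+ M - g = g * (q%:Z ^+ M - 1) by ring.
  by rewrite dvdz_mull.
case: (ex_minnP exP) => t /andP[t0 gt] tmin.
have qt k : (n%:Z %| g * q%:Z ^+ (t * k) - g)%Z.
  by rewrite exprM dvdz_mul_expr // mulrBr mulr1.
have gmod k : (n%:Z %| g * q%:Z ^+ k - g * q%:Z ^+ (k %% t))%Z.
  have -> : g * q%:Z ^+ k - g * q%:Z ^+ (k %% t)
    = (g * q%:Z ^+ (t * (k %/ t)) - g) * q%:Z ^+ (k %% t).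
    by rewrite {1}(divn_eq k t) exprD mulnC; ring.
  by rewrite dvdz_mulr.
have period k : (n%:Z %| g * q%:Z ^+ k - g)%Z = (t %| k)%N.
  apply/idP/dvdnP => [gk|[m ->]]; last by rewrite mulnC.
  exists (k %/ t)%N; have := divn_eq k t; have := ltn_pmod k t0.
  case: (posnP (k %% t)) => [-> _|m0 mt _]; first by rewrite addn0.
  suff /tmin : P (k %% t)%N by lia.
  rewrite /P m0 /=; apply: dvdz_sub_trans gk.
  by rewrite dvdz_sub_sym.
rewrite period; congr (dvdn _ _).
pose f (k : 'I_t) := zres n (g * q%:Z ^+ k).
have f_inj : injective f.
  suff le_inj (a b : 'I_t) : (a <= b)%N -> f a = f b -> a = b.
    by move=> a b; case/orP: (leq_total a b) => ab /[dup] E; [|move/esym]; move=> /le_inj ->.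
  move=> ab /(zres_eqP n0); rewrite dvdz_sub_sym => E; apply/val_inj.
  have : (n%:Z %| g * q%:Z ^+ (b - a) - g)%Z.
    (* [q ^ a] is a unit mod [n]; cancelling it leaves [b - a] as a period below [t], hence zero. *)
    have co : coprimez n%:Z (q%:Z ^+ a) by rewrite -PoszX; apply: coprimeXr.
    rewrite -(Gauss_dvdzl _ co) mulrBl -mulrA -exprD subnK //.
  rewrite period; have /= := ltn_ord b; case: (posnP (b - a)) => [|ba] bt; first lia.
  by move/(dvdn_leq ba); lia.
rewrite -[LHS]card_ord -(card_imset _ f_inj); congr #|pred_of_set _|.
apply/setP => x; apply/imsetP/idP => [[k _ ->]|xg].
  by apply/(mem_cycP n0); exists k; rewrite subrr.
have [y xE] := cyc_zres xg; move: xg; rewrite xE => /(mem_cycP n0)[k yk].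
exists (Ordinal (ltn_pmod k t0)) => //; apply/(zres_eqP n0).
exact: dvdz_sub_trans yk (gmod k).
Qed.

(** * Powers of [Q] in the 2-adic integers *)

(** Each squaring raises the valuation [v + s] by exactly one: the cross term has valuation
    [v + s + 1], and the square term [2 * (v + s)], which is larger because [v > 1]. *)
Lemma expr_pow2 {Q u : int} {v} s : (1 < v)%N -> Q = 1 + 2 ^+ v * (2 * u + 1) ->
  exists w : int, Q ^+ (2 ^ s) = 1 + 2 ^+ (v + s) * (2 * w + 1).
Proof.
move=> v1 QE; elim: s => [|s [w IH]]; first by exists u; rewrite addn0.
have [m mE] : exists m, (v + s = m.+2)%N by exists (v + s - 2)%N; lia.
exists (w + 2 ^+ m * (2 * w + 1) ^+ 2).
rewrite expnSr exprM IH addnS mE !exprS; ring.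
Qed.

(* For v > 1 the powers of 1 + 2^v u, u odd, are dense in 1 + 2^v Z_2: each
   power Q^(2^s) corrects one further binary digit. *)
Lemma pow2_orbit {Q u x y : int} {v d} i : (1 < v)%N -> Q = 1 + 2 ^+ v * (2 * u + 1) ->
  (2 ^+ d %| x)%Z -> ~~ (2 ^+ d.+1 %| x)%Z -> (2 ^+ (d + v) %| y - x)%Z ->
  exists k, (2 ^+ i %| y - x * Q ^+ k)%Z.
Proof.
move=> v1 QE /dvdzP[x' ->]; rewrite exprS dvdz_mul2r ?expf_neq0 // => x'_odd yx.
have [w wE] : exists w : int, x' = 2 * w + 1 by exists (x' %/ 2)%Z; lia.
have Q_odd k : exists z : int, Q ^+ k = 2 * z + 1.
  elim: k => [|k [z zE]]; first by exists 0.
  exists (z + 2 ^+ v.-1 * (2 * u + 1) * (2 * z + 1)).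
  rewrite exprS zE QE -[in LHS](prednK (ltnW v1)) exprS; ring.
elim: i => [|i [k]]; first by exists 0%N; rewrite dvd1z.
case: (leqP i.+1 (d + v)) => [idv _|dvi].
  exists 0%N; rewrite mulr1; apply: dvdz_trans yx; exact: dvdz_exp2l.
move=> /dvdzP[r rE].
have [r_even|r_odd] := boolP (2 %| r)%Z.
  by exists k; rewrite rE exprS dvdz_mul2r ?expf_neq0.
have [s sE] : exists s, i = (d + v + s)%N by exists (i - (d + v))%N; lia.
have [z zE] := expr_pow2 s v1 QE; have [a aE] := Q_odd k.
(* As [i = d + v + s], the factor [Q ^ (2 ^ s)] changes [x * Q ^ k] by an odd multiple of [2 ^ i],
   which makes the odd quotient [r] even. *)
exists (k + 2 ^ s)%N.
have -> : y - x' * 2 ^+ d * Q ^+ (k + 2 ^ s)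
  = (r - (2 * w + 1) * (2 * a + 1) * (2 * z + 1)) * 2 ^+ i.
  rewrite mulrBl -rE exprD zE aE wE sE !exprD; ring.
rewrite exprS dvdz_mul2r ?expf_neq0 //; move: r_odd; lia.
Qed.

(** * Cosets modulo [2 ^ i * n] *)

Lemma coprimez_pow2 {q} i j : odd q -> coprimez (2 ^+ i) (q%:Z ^+ j).
Proof. by move=> q_odd; rewrite -!PoszX coprimezE coprimeXl ?coprimeXr // coprime2n. Qed.

Lemma dvdz_pow2_mul {n i} (x : int) : odd n ->
  ((2 ^ i * n)%N%:Z %| x)%Z = (2 ^+ i %| x)%Z && (n%:Z %| x)%Z.
Proof.
move=> n_odd; rewrite PoszM PoszX Gauss_dvdz //.
exact: (coprimez_pow2 i 1 n_odd).
Qed.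

Lemma level_gt0 {n} : (0 < n)%N -> forall i, (0 < 2 ^ i * n)%N.
Proof. by move=> n0 i; rewrite muln_gt0 expn_gt0. Qed.

Lemma coprime_level {q n} : odd q -> coprime n q -> forall i, coprime (2 ^ i * n) q.
Proof. by move=> q_odd nq i; rewrite coprimeMl nq andbT coprimeXl // coprime2n. Qed.

(** Modulo [n], [q ^ j] fixes [g] only if the size of the coset divides [j]; this leaves the powers
    of [Q] modulo [2 ^ i]. The modulus [N] is a variable so that [2 * (2 ^ i * n)] fits as well. *)
Lemma eq_cyc_level {q n N i} {g h : int} :
  odd n -> odd q -> coprime n q -> N = (2 ^ i * n)%N ->
  (n%:Z %| h - g)%Z ->
  cyc q N h = cyc q N g <->
  exists k, (2 ^+ i %| h - g * (q%:Z ^+ #|cyc q n g|) ^+ k)%Z.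
Proof.
move=> n_odd q_odd nq NE hg; have n0 := odd_gt0 n_odd.
have N0 : (0 < N)%N by rewrite NE level_gt0.
have Nq : coprime N q by rewrite NE coprime_level.
rewrite eq_cycP // NE; split=> [[j]|[k hk]].
  rewrite dvdz_pow2_mul // => /andP[h2 hn].
  have : (n%:Z %| g * q%:Z ^+ j - g)%Z.
    by apply: dvdz_sub_trans hg; rewrite dvdz_sub_sym.
  by rewrite card_cyc // => /dvdnP[k jE]; exists k; rewrite -exprM mulnC -jE.
exists (#|cyc q n g| * k)%N; rewrite dvdz_pow2_mul // exprM hk /=.
apply: dvdz_sub_trans hg _; rewrite dvdz_sub_sym -exprM card_cyc //.
exact: dvdn_mulr.
Qed.

(** Powers of [q] are odd, so the 2-adic valuation is a coset invariant as far as the modulus sees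
    it. *)
Lemma eq_cyc_dvd {q N k} {g h : int} : odd q -> (0 < N)%N -> coprime N q ->
  (2 ^+ k %| N%:Z)%Z -> cyc q N h = cyc q N g ->
  (2 ^+ k %| h)%Z = (2 ^+ k %| g)%Z.
Proof.
move=> q_odd N0 Nq kN /(eq_cycP N0 Nq)[j /(dvdz_trans kN)/dvdz_sub_iff ->].
by rewrite Gauss_dvdzl // coprimez_pow2.
Qed.

(** Powers of [Q], being 1 mod [2 ^ v], move a multiple of [2 ^ j] by multiples of [2 ^ (j + v)];
    the minimum accounts for the precision [i] of the level. *)
Lemma eq_cyc_congr {q n N i j v} {u g h : int} :
  odd n -> odd q -> coprime n q -> N = (2 ^ i * n)%N ->
  q%:Z ^+ #|cyc q n g| = 1 + 2 ^+ v * u ->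
  (n%:Z %| h - g)%Z -> (2 ^+ j %| g)%Z -> cyc q N h = cyc q N g ->
  (2 ^+ minn i (j + v) %| h - g)%Z.
Proof.
move=> n_odd q_odd nq NE QE hg gj /(eq_cyc_level n_odd q_odd nq NE hg)[k hk].
have iP : (2 ^+ minn i (j + v) %| (2 : int) ^+ i)%Z by rewrite dvdz_exp2l ?geq_minl.
apply: dvdz_sub_trans (dvdz_trans iP hk) _.
apply: (dvdz_trans (dvdz_exp2l _ (geq_minr i (j + v)))).
by rewrite dvdz_mul_expr // QE [1 + _]addrC addrK exprD dvdz_mul // dvdz_mulr.
Qed.

(** Converse to [eq_cyc_congr] at valuation exactly [d]: by density of the powers of [Q], the ball
    of radius [2 ^ (d + v)] around [g] is one orbit. *)
Lemma congr_eq_cyc {q n N i d v} {u g h : int} :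
  odd n -> odd q -> coprime n q -> N = (2 ^ i * n)%N ->
  (1 < v)%N -> q%:Z ^+ #|cyc q n g| = 1 + 2 ^+ v * (2 * u + 1) ->
  (n%:Z %| h - g)%Z -> (2 ^+ d %| g)%Z -> ~~ (2 ^+ d.+1 %| g)%Z ->
  (2 ^+ (d + v) %| h - g)%Z -> cyc q N h = cyc q N g.
Proof.
move=> n_odd q_odd nq NE v1 QE hg gd gd1 hgd.
exact/(eq_cyc_level n_odd q_odd nq NE hg)/(pow2_orbit i v1 QE gd gd1 hgd).
Qed.

(** * Splitting of cosets *)

Lemma cyc_neq_disjoint {q N} {g h : int} : (0 < N)%N -> coprime N q ->
  [disjoint cyc q N g & cyc q N h] <-> cyc q N h <> cyc q N g.
Proof.
move=> N0 Nq; split=> [D E|ne].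
  have g_in : zres N g \in cyc q N g.
    by apply/(mem_cycP N0); exists 0%N; rewrite mulr1 subrr.
  by have := disjointFr D g_in; rewrite E g_in.
rewrite disjoints_subset; apply/fintype.subsetP => x xg; rewrite inE; apply/negP => xh.
have [y xE] := cyc_zres xg; move: xg xh; rewrite xE.
move=> /(mem_cycP N0)/(eq_cycP N0 Nq) E /(mem_cycP N0)/(eq_cycP N0 Nq) E'.
by apply: ne; rewrite -E.
Qed.

Lemma proj_zres b a h : (0 < b)%N -> (a %| b)%N -> proj b a (zres b h) = zres a h.
Proof.
move=> b0 ab; have a0 := dvdn_gt0 b0 ab.
apply/(zres_eqP a0); rewrite (val_zres h b0) dvdz_sub_sym.
apply: (@dvdz_trans b%:Z); first exact: ab.
by rewrite {1}(divz_eq h b%:Z) addrK dvdz_mull.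
Qed.

(** As [q ^ j] is odd, [m * q ^ j] is [m] mod [2 * m]. The two lifts of [g * q ^ j] are thus
    [g * q ^ j] and [(m + g) * q ^ j], so the preimage is the union of the two cosets, which are
    disjoint as soon as they differ. *)
Lemma splittingP {q m} {g : int} : (0 < m)%N -> odd q -> coprime m q ->
  splitting q m g <-> cyc q (2 * m)%N (m%:Z + g) <> cyc q (2 * m)%N g.
Proof.
move=> m0 q_odd mq; have M0 : (0 < 2 * m)%N by lia.
have Mq : coprime (2 * m) q by rewrite coprimeMl mq coprime2n q_odd.
have mM : (m %| 2 * m)%N by rewrite dvdn_mull.
rewrite /splitting cyc_neq_disjoint //; split=> [[]//|ne]; split=> //.
have odd_qX j : exists r : int, q%:Z ^+ j = 2 * r + 1.
  exists (q ^ j)./2%:Z; rewrite -PoszX.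
  by have := odd_double_half (q ^ j); rewrite oddX q_odd orbT; lia.
apply/setP => x; have [y ->] : exists y, x = zres (2 * m) y.
  exists (val x)%:Z; apply: val_inj; apply/eqP; rewrite -eqz_nat val_zres //.
  by rewrite modz_small //=; apply: leq_trans (ltn_ord x) _; rewrite prednK.
rewrite in_setU inE proj_zres //; apply/idP/orP.
  move=> /(mem_cycP m0)[j /dvdzP[c cE]]; have [r rE] := odd_qX j.
  have [c_even|c_odd] := boolP (2 %| c)%Z.
    left; apply/(mem_cycP M0); exists j.
    by rewrite cE PoszM dvdz_mul.
  right; apply/(mem_cycP M0); exists j.
  have -> : y - (m%:Z + g) * q%:Z ^+ j = (c - q%:Z ^+ j) * m%:Z.
    by rewrite mulrBl -cE; ring.
  rewrite rE PoszM dvdz_mul //; move: c_odd; lia.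
have mM' : (m%:Z %| (2 * m)%N%:Z)%Z by [].
case=> /(mem_cycP M0)[j /(dvdz_trans mM') yj]; apply/(mem_cycP m0); exists j => //.
apply: dvdz_sub_trans yj _.
by rewrite -mulrBl addrK dvdz_mulr.
Qed.

(** * Binary digits and 2-adic valuations *)

Lemma dvdz_pow2_odd {n i} (x : int) : odd n -> (2 ^+ i %| n%:Z * x)%Z = (2 ^+ i %| x)%Z.
Proof. by move=> n_odd; rewrite Gauss_dvdzr //; apply: (coprimez_pow2 i 1 n_odd). Qed.

Lemma trunc_sub Y {i j} : (i <= j)%N -> (2 ^+ i %| (trunc Y j)%:Z - (trunc Y i)%:Z)%Z.
Proof.
move/subnKC <-; elim: (j - i)%N => [|k IH]; first by rewrite addn0 subrr dvdz0.
apply: dvdz_sub_trans IH; rewrite addnS truncS PoszD [X in X - _]addrC addrK PoszM PoszX.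
by rewrite dvdz_mull // dvdz_exp2l // leq_addr.
Qed.

Lemma trunc_ext {Y Z i} : (forall k, (k < i)%N -> Y k = Z k) -> trunc Y i = trunc Z i.
Proof. by move=> YZ; apply: eq_bigr => k _; rewrite YZ. Qed.

(** Once the lower digits agree, what remains is [2 ^ i] times the difference of the top digits,
    which is even only when zero. *)
Lemma trunc_inj {Y Z i} : (2 ^+ i %| (trunc Y i)%:Z - (trunc Z i)%:Z)%Z ->
  forall k, (k < i)%N -> Y k = Z k.
Proof.
elim: i => // i IH YZ.
have le_YZ k : (k < i)%N -> Y k = Z k.
  apply: IH; apply: dvdz_sub_trans (trunc_sub Z (leqnSn i)).
  apply: (dvdz_sub_trans (trunc Y i.+1)%:Z); first by rewrite dvdz_sub_sym trunc_sub.
  by apply: dvdz_trans YZ; rewrite dvdz_exp2l.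
move=> k; rewrite ltnS leq_eqVlt => /orP[/eqP ->|]; last exact: le_YZ.
move: YZ; rewrite !truncS (trunc_ext le_YZ) !PoszD opprD addrACA subrr add0r.
rewrite !PoszM -mulrBl PoszX exprS dvdz_mul2r ?expf_neq0 //.
by case: (Y i) (Z i) => [] [].
Qed.

Lemma gen_sub {n gamma Y i j} : (i <= j)%N ->
  ((2 ^ i * n)%N%:Z %| gamma + n%:Z * (trunc Y j)%:Z - (gamma + n%:Z * (trunc Y i)%:Z))%Z.
Proof.
move=> ij; rewrite opprD addrACA subrr add0r -mulrBr PoszM mulrC PoszX.
by rewrite dvdz_mul // trunc_sub.
Qed.

(** [n] is invertible mod [2 ^ i], so a single choice of the first [i] digits gives divisibility.
    Valuations of representatives thus measure agreement with [phi]. *)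
Lemma phi_digits {n gamma Y i} : odd n ->
  (2 ^+ i %| gamma + n%:Z * (trunc Y i)%:Z)%Z <->
  (forall k, (k < i)%N -> Y k = phi n gamma k).
Proof.
move=> n_odd.
have phi0 : (2 ^+ i %| gamma + n%:Z * (trunc (phi n gamma) i)%:Z)%Z.
  by case: i => [|i]; [exact: dvd1z|rewrite -PoszX; exact: phiP].
split=> [Yi|/trunc_ext -> //]; apply: trunc_inj.
rewrite -(dvdz_pow2_odd _ n_odd).
have -> : n%:Z * ((trunc Y i)%:Z - (trunc (phi n gamma) i)%:Z)
  = gamma + n%:Z * (trunc Y i)%:Z - (gamma + n%:Z * (trunc (phi n gamma) i)%:Z) by ring.
by rewrite rpredB.
Qed.

(** [Uhat] follows [phi] below degree [d] and departs from it at [d], so beyond level [d] its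
    representatives have valuation [d], whatever [t]. *)
Lemma dvdz_Uhat {n gamma d r} {t : r.-tuple bool} {i} : odd n ->
  (2 ^+ i %| gamma + n%:Z * (trunc (Uhat n gamma d t) i)%:Z)%Z = (i <= d)%N.
Proof.
move=> n_odd; apply/idP/idP => [/(phi_digits n_odd)|id].
  case: leqP => // di /(_ d di).
  by rewrite /Uhat leqnn /U ltnn eqxx; case: (phi n gamma d).
apply/(phi_digits n_odd) => k ki; have kd := leq_trans ki id.
by rewrite /Uhat (ltnW kd) /U kd.
Qed.

Lemma gen_subr n (gamma : int) Y i : (n%:Z %| gamma + n%:Z * (trunc Y i)%:Z - gamma)%Z.
Proof. by rewrite [X in X - _]addrC addrK dvdz_mulr. Qed.

(** * Elements of the inverse limit and their representatives *)

Lemma gen_PC {q n} gamma Y : odd n -> odd q -> coprime n q -> PC q n gamma (gen q n gamma Y).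
Proof.
move=> n_odd q_odd nq; have n0 := odd_gt0 n_odd.
have N0 := level_gt0 n0; have Nq := coprime_level q_odd nq.
split=> [i|i j ij].
  split; first by exists (gamma + n%:Z * (trunc Y i)%:Z).
  rewrite /gen hatproj_cyc // ?dvdn_mull //; apply: congr_cyc => //.
  exact: gen_subr.
rewrite /gen hatproj_cyc // ?dvdn_mul ?dvdn_exp2l //; apply: congr_cyc => //.
exact: gen_sub.
Qed.

(** A power of [q] moves a representative into the class of [gamma] mod [n], so that [eq_cyc_level]
    can compare it with others. *)
Lemma PC_rep {q n gamma} {s : coset_seq n} i :
  odd n -> odd q -> coprime n q -> PC q n gamma s ->
  exists g : int, (n%:Z %| g - gamma)%Z /\ s i = cyc q (2 ^ i * n)%N g.
Proof.
move=> n_odd q_odd nq [/(_ i)[[g _ sE] sn] _]; have n0 := odd_gt0 n_odd.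
have N0 := level_gt0 n0 i; have Nq := coprime_level q_odd nq i.
move: sn; rewrite -sE hatproj_cyc // ?dvdn_mull // => /esym/(eq_cycP n0 nq)[j gj].
exists (g * q%:Z ^+ j); split; first by rewrite dvdz_sub_sym.
by apply/esym/eq_cycP => //; exists j; rewrite subrr.
Qed.

Lemma PC_proj {q n gamma} {s : coset_seq n} {i j} {g : int} :
  (0 < n)%N -> PC q n gamma s -> (i <= j)%N ->
  s j = cyc q (2 ^ j * n)%N g -> s i = cyc q (2 ^ i * n)%N g.
Proof.
move=> n0 [_ /(_ i j) sij] ij sE; rewrite -(sij ij) sE hatproj_cyc //.
  exact: level_gt0.
by rewrite dvdn_mul ?dvdn_exp2l.
Qed.

Lemma PC_tail {q n gamma} {s s' : coset_seq n} N :
  PC q n gamma s -> PC q n gamma s' ->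
  (forall i, (N <= i)%N -> s i = s' i) -> s = s'.
Proof.
move=> [_ sP] [_ sP'] E; apply: functional_extensionality_dep => i.
rewrite -(sP i (maxn i N)) ?leq_maxl // -(sP' i (maxn i N)) ?leq_maxl //.
by rewrite E ?leq_maxr.
Qed.

(** Divisibility of [q ^ tau - 1] by 4 gives [v > 1], and [2 * u + 1] is its odd part. *)
Lemma logn2_decomp {q tau v} : odd q -> (0 < tau)%N -> (1 < q)%N ->
  q ^ tau = 1 %[mod 4] -> v = logn 2 (q ^ tau - 1) ->
  (1 < v)%N /\ exists u : int, q%:Z ^+ tau = 1 + 2 ^+ v * (2 * u + 1).
Proof.
move=> q_odd tau0 q1 q4 ->.
have Q1 : (1 < q ^ tau)%N by rewrite -(exp1n tau) ltn_exp2r.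
have d0 : (0 < q ^ tau - 1)%N by rewrite subn_gt0.
split.
  rewrite (leq_trans (_ : (1 < 2)%N)) // -(pfactor_dvdn 2 _ d0) //.
  by rewrite -eqn_mod_dvd ?(ltnW Q1) //; apply/eqP.
have [m m_odd mE] := pfactor_coprime (isT : prime 2) d0.
exists m./2%:Z; rewrite -!PoszX; move: m_odd; rewrite coprime2n => m_odd.
have -> : 2 * m./2%:Z + 1 = m%:Z by have := odd_double_half m; rewrite m_odd; lia.
rewrite -PoszM mulnC -mE; lia.
Qed.

Lemma pow2_level n i : (2 ^+ i %| (2 ^ i * n)%N%:Z)%Z.
Proof. by rewrite PoszM PoszX dvdz_mulr. Qed.

(** * Distinctness and exhaustion of the generators *)

Lemma gen_dvd {q n gamma Y Z} i : odd n -> odd q -> coprime n q ->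
  gen q n gamma Y = gen q n gamma Z ->
  (2 ^+ i %| gamma + n%:Z * (trunc Y i)%:Z)%Z = (2 ^+ i %| gamma + n%:Z * (trunc Z i)%:Z)%Z.
Proof.
move=> n_odd q_odd nq /(congr1 (@^~ i)).
apply: eq_cyc_dvd (pow2_level n i) => //; first exact/level_gt0/odd_gt0.
exact: coprime_level.
Qed.

Lemma gen_phi_neq_Uhat {q n gamma d r} {t : r.-tuple bool} :
  odd n -> odd q -> coprime n q ->
  gen q n gamma (phi n gamma) <> gen q n gamma (Uhat n gamma d t).
Proof.
move=> n_odd q_odd nq /(gen_dvd d.+1 n_odd q_odd nq); rewrite dvdz_Uhat // ltnn.
by move/negbT/negP; apply; apply/phi_digits.
Qed.

(** The valuation recovers [d]. At level [d + v], equal cosets force congruence mod [2 ^ (d + v)],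
    hence equal digits; those of degrees [d + 1] to [d + v - 1] form [t]. *)
Lemma gen_Uhat_inj {q n gamma v d d'} {u : int} {t t' : v.-1.-tuple bool} :
  odd n -> odd q -> coprime n q ->
  q%:Z ^+ #|cyc q n gamma| = 1 + 2 ^+ v * u ->
  gen q n gamma (Uhat n gamma d t) = gen q n gamma (Uhat n gamma d' t') ->
  d = d' /\ t = t'.
Proof.
move=> n_odd q_odd nq QE E.
have dE i : (i <= d)%N = (i <= d')%N.
  by have := gen_dvd i n_odd q_odd nq E; rewrite !dvdz_Uhat.
have dd : d = d' by apply/eqP; rewrite eqn_leq -dE leqnn dE leqnn.
split=> //; move: E; rewrite -{}dd => {dE d'} /(congr1 (@^~ (d + v)%N)) E.
set g' := gamma + n%:Z * (trunc (Uhat n gamma d t') (d + v))%:Z.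
have gd : (2 ^+ d %| g')%Z.
  have dv : (d <= d + v)%N by rewrite leq_addr.
  by rewrite (dvdz_sub_iff _ _ _ (dvdz_trans (pow2_level n d) (gen_sub dv))) dvdz_Uhat.
have n_eq : (n%:Z %| gamma + n%:Z * (trunc (Uhat n gamma d t) (d + v))%:Z - g')%Z.
  by apply: dvdz_sub_trans (gen_subr _ _ _ _) _; rewrite dvdz_sub_sym gen_subr.
rewrite -(congr_cyc (odd_gt0 n_odd) nq (gen_subr _ _ (Uhat n gamma d t') (d + v))) in QE.
have := eq_cyc_congr n_odd q_odd nq erefl QE n_eq gd E.
rewrite minnn opprD addrACA subrr add0r -mulrBr dvdz_pow2_odd // => /trunc_inj UU.
apply: eq_from_tnth => j; have jv := ltn_ord j.
have /UU : (d.+1 + j < d + v)%N by lia.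
rewrite /Uhat !(tnth_nth false) addSn addnC.
have -> : ((j + d).+1 <= d)%N = false by lia.
by have -> : ((j + d).+1 - d).-1 = j by lia.
Qed.

(* If the representatives of s are not all divisible by the corresponding
   powers of 2, they share a 2-adic valuation d from some level on; then s is
   determined by its component of degree d + v, whose binary digits beyond the
   d-th provide the tuple t. *)
Lemma PC_exhaust {q n gamma v} {u : int} {s : coset_seq n} :
  odd n -> odd q -> coprime n q -> (1 < v)%N ->
  q%:Z ^+ #|cyc q n gamma| = 1 + 2 ^+ v * (2 * u + 1) -> PC q n gamma s ->
  s = gen q n gamma (phi n gamma) \/
  exists d (t : v.-1.-tuple bool), s = gen q n gamma (Uhat n gamma d t).
Proof.
move=> n_odd q_odd nq v1 QE sPC; have rep i := PC_rep i n_odd q_odd nq sPC.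
have n0 := odd_gt0 n_odd; have N0 := level_gt0 n0; have Nq := coprime_level q_odd nq.
have QE' (g : int) : (n%:Z %| g - gamma)%Z ->
    q%:Z ^+ #|cyc q n g| = 1 + 2 ^+ v * (2 * u + 1).
  by move/(congr_cyc (odd_gt0 n_odd) nq) => ->.
pose P i := `[< exists g : int, [/\ (n%:Z %| g - gamma)%Z,
  s i = cyc q (2 ^ i * n)%N g & ~~ (2 ^+ i %| g)%Z] >].
have [exP|noP] := pselect (exists i, P i); last first.
  (* Every representative is then 0 mod [2 ^ i], like that of [phi], and both are [gamma] mod
     [n]. *)
  left; apply: functional_extensionality_dep => i.
  have [g [gn sE]] := rep i; rewrite sE /gen; apply: congr_cyc => //.
  rewrite dvdz_pow2_mul // rpredB //=.
  - by apply: dvdz_sub_trans gn _; rewrite dvdz_sub_sym gen_subr.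
  - by case: (boolP (2 ^+ i %| g)%Z) => // gi; case: noP; exists i; apply/asboolP; exists g.
  - exact/phi_digits.
(* Level 0 is excluded since [2 ^ 0] divides everything; the least level is [d.+1], and [d] will be
   the valuation. *)
right; case: (ex_minnP exP) => -[|d] Pd dmin.
  by case/asboolP: Pd => g [_ _]; rewrite dvd1z.
have [g [gn sE]] := rep (d + v)%N.
have gd1 : ~~ (2 ^+ d.+1 %| g)%Z.
  case/asboolP: Pd => h [_ hE].
  rewrite (eq_cyc_dvd (g := g) q_odd (N0 d.+1) (Nq d.+1) (pow2_level n d.+1)) //.
  by rewrite -hE; apply: (PC_proj n0 sPC _ sE); lia.
have gd : (2 ^+ d %| g)%Z.
  apply: contraT => gd; suff /dmin : P d by rewrite ltnn.
  by apply/asboolP; exists g; split=> //; apply: (PC_proj n0 sPC _ sE); lia.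
(* [Y] is the 2-adic expansion of [(g - gamma) / n], so [x i] approximates [g]. *)
pose Y := phi n (gamma - g).
pose x i := gamma + n%:Z * (trunc Y i)%:Z.
have xg : (2 ^+ (d + v) %| x (d + v)%N - g)%Z.
  have := phiP (gamma - g) n_odd (d + v).-1.
  by rewrite prednK ?PoszX ?[_ - _ + _]addrAC //; lia.
have xgi i : (i <= d + v)%N -> (2 ^+ i %| x i)%Z = (2 ^+ i %| g)%Z.
  move=> ile; apply: dvdz_sub_iff; apply: dvdz_sub_trans (dvdz_trans (dvdz_exp2l _ ile) xg).
  by rewrite dvdz_sub_sym; apply: dvdz_trans (pow2_level n i) (gen_sub ile).
pose t := [tuple Y (d.+1 + j)%N | j < v.-1]; exists d, t.
have lowY k : (k < d)%N -> Y k = phi n gamma k.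
  by move: k; apply/(phi_digits n_odd); rewrite xgi // leq_addr.
(* Agreement at degree [d] too would make [g] divisible by [2 ^ d.+1]. *)
have Yd : Y d = ~~ phi n gamma d.
  apply/eqP; apply: contraNT gd1 => Yd; rewrite -xgi; last lia.
  apply/(phi_digits n_odd) => k; rewrite ltnS leq_eqVlt => /orP[/eqP ->|/lowY //].
  by case: (Y d) (phi n gamma d) Yd => [] [].
have UY k : (k < d + v)%N -> Uhat n gamma d t k = Y k.
  move=> kdv; rewrite /Uhat /U; case: ltngtP => //= [/lowY -> //|dk|-> //].
  have kv : ((k - d).-1 < v.-1)%N by lia.
  rewrite -[LHS]/(nth false t (Ordinal kv)) -tnth_nth tnth_mktuple; congr (Y _) => /=; lia.
apply: (PC_tail (d + v) sPC (gen_PC gamma _ n_odd q_odd nq)) => i dvi.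
have [h [hn shE]] := rep i; rewrite shE /gen; apply/esym.
have ghE := PC_proj n0 sPC dvi shE.
have hg : (2 ^+ (d + v) %| h - g)%Z.
  have := eq_cyc_congr n_odd q_odd nq erefl (QE' _ gn) _ gd (etrans (esym ghE) sE).
  by rewrite minnn; apply; apply: dvdz_sub_trans hn _; rewrite dvdz_sub_sym.
have dvdh j : (j <= d + v)%N -> (2 ^+ j %| h)%Z = (2 ^+ j %| g)%Z.
  by move=> jle; apply: dvdz_sub_iff; apply: dvdz_trans hg; rewrite dvdz_exp2l.
(* Both representatives are congruent to [g] mod [2 ^ (d + v)], and [h] has valuation [d]: they lie
   in one orbit. *)
apply: (congr_eq_cyc (d := d) n_odd q_odd nq erefl v1 (QE' _ hn)).
- by apply: dvdz_sub_trans (gen_subr _ _ _ _) _; rewrite dvdz_sub_sym.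
- by rewrite dvdh // leq_addr.
- by rewrite dvdh //; lia.
- apply: (dvdz_sub_trans g); last by rewrite dvdz_sub_sym.
  apply: dvdz_sub_trans xg; rewrite /x -(trunc_ext UY).
  exact: dvdz_trans (pow2_level n _) (gen_sub dvi).
Qed.

(** * Splitting behaviour of the generators *)

(** The representative at degree [i] is a multiple of [2 ^ i], so it is fixed by [Q] mod [2 ^ i.+1];
    a shift by [2 ^ i * n], with [n] odd, leaves its orbit. *)
Lemma splitting_gen_phi {q n gamma v} {u : int} :
  odd n -> odd q -> coprime n q -> (0 < v)%N ->
  q%:Z ^+ #|cyc q n gamma| = 1 + 2 ^+ v * u ->
  splitting_seq q (gen q n gamma (phi n gamma)).
Proof.
move=> n_odd q_odd nq v0 QE i; have n0 := odd_gt0 n_odd.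
set g := gamma + n%:Z * (trunc (phi n gamma) i)%:Z; exists g; split=> //.
apply/(splittingP (level_gt0 n0 i) q_odd (coprime_level q_odd nq i)) => E.
have gi : (2 ^+ i %| g)%Z by apply/phi_digits.
rewrite -(congr_cyc (odd_gt0 n_odd) nq (gen_subr _ _ (phi n gamma) i)) in QE.
have NE : (2 * (2 ^ i * n) = 2 ^ i.+1 * n)%N by rewrite expnS mulnA.
have := eq_cyc_congr n_odd q_odd nq NE QE _ gi E.
rewrite addrK (minn_idPl _) ?PoszM ?PoszX; last lia.
rewrite dvdz_mull // => /(_ isT).
rewrite mulrC dvdz_pow2_odd // exprS -[X in (_ %| X)%Z]mul1r dvdz_mul2r ?expf_neq0 //.
Qed.

(** Splitting fails at degree [d + v]: the shift by [2 ^ (d + v) * n] stays in the ball that is the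
    orbit of a representative of valuation [d]. *)
Lemma not_splitting_gen_Uhat {q n gamma v d r} {u : int} {t : r.-tuple bool} :
  odd n -> odd q -> coprime n q -> (1 < v)%N ->
  q%:Z ^+ #|cyc q n gamma| = 1 + 2 ^+ v * (2 * u + 1) ->
  ~ splitting_seq q (gen q n gamma (Uhat n gamma d t)).
Proof.
move=> n_odd q_odd nq v1 QE /(_ (d + v)%N)[g []]; have n0 := odd_gt0 n_odd.
have N0 := level_gt0 n0 (d + v); have Nq := coprime_level q_odd nq (d + v).
move=> gE /(splittingP N0 q_odd Nq); apply.
(* [g] is an arbitrary representative of the component, so its valuation is first carried over from
   the generator. *)
have dvd_g k : (k <= d + v)%N -> (2 ^+ k %| g)%Z = (k <= d)%N.
  move=> kle; have kN : (2 ^+ k %| (2 ^ (d + v) * n)%N%:Z)%Z.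
    by apply: dvdz_trans (pow2_level n _); rewrite dvdz_exp2l.
  rewrite -(eq_cyc_dvd q_odd N0 Nq kN gE) -(dvdz_Uhat (t := t) (gamma := gamma) n_odd).
  by apply: dvdz_sub_iff; apply: dvdz_trans (pow2_level n k) (gen_sub kle).
have cgE : cyc q n g = cyc q n gamma.
  rewrite -(congr_cyc (odd_gt0 n_odd) nq (gen_subr n gamma (Uhat n gamma d t) (d + v))).
  by have := congr1 (hatproj n) gE; rewrite /gen !hatproj_cyc ?dvdn_mull.
have NE : (2 * (2 ^ (d + v) * n) = 2 ^ (d + v).+1 * n)%N by rewrite expnS mulnA.
rewrite -cgE in QE; apply: (congr_eq_cyc n_odd q_odd nq NE v1 QE (d := d)).
- by rewrite addrK PoszM dvdz_mull.
- by rewrite dvd_g // leq_addr.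
- by rewrite dvd_g ?ltnn //; lia.
- by rewrite addrK pow2_level.
Qed.

(* Classification of the elements of [PC] *)
Local Close Scope ring_scope.

Theorem theorem3p2 (p e q n : nat) (gamma : int) (tau v : nat)
  (p_prime : prime p) (p_odd : odd p) (e_pos : (0 < e)%N) (qE : q = (p ^ e)%N)
  (n_odd : odd n) (n_coprime : coprime n q)
  (tauE : #|cyc q n gamma| = tau)
  (vE : v = logn 2 (q ^ tau - 1))
  (q_tau : q ^ tau = 1 %[mod 4]) :
  let c_inf : coset_seq n := gen q n gamma (phi n gamma) in
  let c (d : nat) (t : v.-1.-tuple bool) : coset_seq n :=
    gen q n gamma (Uhat n gamma d t) in
  (PC q n gamma c_inf /\ splitting_seq q c_inf /\
   (forall s : coset_seq n, PC q n gamma s -> splitting_seq q s -> s = c_inf)) /\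
  (forall d t, PC q n gamma (c d t)) /\
  (forall d t, c_inf <> c d t) /\
  (forall d t d' t', c d t = c d' t' -> d = d' /\ t = t') /\
  (forall s : coset_seq n, PC q n gamma s ->
     s = c_inf \/ exists d t, s = c d t).
Proof.
have q_odd : odd q by rewrite qE oddX p_odd orbT.
have q1 : (1 < q)%N by rewrite qE -(exp1n e) ltn_exp2r // prime_gt1.
have n0 := odd_gt0 n_odd.
have tau0 : (0 < tau)%N.
  rewrite -tauE card_gt0; apply/set0Pn; exists (zres n gamma).
  by apply/(mem_cycP n0); exists 0%N; rewrite mulr1 subrr.
have [v1 [u QE]] := logn2_decomp q_odd tau0 q1 q_tau vE.
rewrite -tauE in QE.
have exhaust s := PC_exhaust (s := s) n_odd q_odd n_coprime v1 QE.
move=> c_inf c; split; first split; first exact: gen_PC.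
  split; first exact: splitting_gen_phi (ltnW v1) QE.
  (* Uniqueness follows from exhaustion, since no [c d t] is splitting. *)
  move=> s /exhaust[//|[d [t ->]]].
  by move/(not_splitting_gen_Uhat n_odd q_odd n_coprime v1 QE).
split=> [d t|]; first exact: gen_PC.
split=> [d t|]; first exact: gen_phi_neq_Uhat.
by split=> // d t d' t'; apply: gen_Uhat_inj QE.
Qed.
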